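(* Let $\mathscr{F}=\{[0),[1)\}$, and let $S=\boldsymbol{End}^*(\boldsymbol{B}_{\omega}^{\mathscr{F}})$ be the semigroup of all non-injective non-annihilating monoid endomorphisms of $\boldsymbol{B}_{\omega}^{\mathscr{F}}$. Let $\mathscr{R},\mathscr{L},\mathscr{H},\mathscr{D},\mathscr{J}$ denote Green's relations on $S$. Then the following statements hold, where $k_1,k_2$ range over all positive integers and $\mathfrak{e}_1,\mathfrak{e}_2$ over all elements of $S$: (1) $\gamma_{k_1}\mathscr{R}\gamma_{k_2}$ if and only if $k_1=k_2$; (2) $\gamma_{k_1}\mathscr{R}\delta_{k_2}$ does not hold for any $\gamma_{k_1},\delta_{k_2}$; (3) $\delta_{k_1}\mathscr{R}\delta_{k_2}$ if and only if $k_1=k_2$; (4) $\gamma_{k_1}\mathscr{L}\gamma_{k_2}$ if and only if $k_1=k_2$; (5) $\gamma_{k_1}\mathscr{L}\delta_{k_2}$ if and only if $k_1=k_2$; (6) $\delta_{k_1}\mathscr{L}\delta_{k_2}$ if and only if $k_1=k_2$; (7) $\mathscr{H}$ is the identity relation on $S$; (8) $\mathfrak{e}_1\mathscr{D}\mathfrak{e}_2$ if and only if $\mathfrak{e}_1=\mathfrak{e}_2$ or there exists a positive integer $k$ such that $\mathfrak{e}_1,\mathfrak{e}_2\in\{\gamma_k,\delta_k\}$; (9) $\mathscr{D}=\mathscr{J}$ on $S$.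
   Context: $\omega$ is the set of non-negative integers; for $a\in\omega$, $[a)=\{x\in\omega: x\geqslant a\}$; for $n\in\mathbb{Z}$ and $F\subseteq\omega$, $n+F=\{n+k: k\in F\}$. For $\mathscr{F}=\{[0),[1)\}$, $\boldsymbol{B}_{\omega}^{\mathscr{F}}$ is the set $\omega\times\omega\times\mathscr{F}$ with the operation $$(i_1,j_1,F_1)\cdot(i_2,j_2,F_2)=\begin{cases}(i_1-j_1+i_2,\,j_2,\,(j_1-i_2+F_1)\cap F_2), & j_1\leqslant i_2;\\ (i_1,\,j_1-i_2+j_2,\,F_1\cap(i_2-j_1+F_2)), & j_1\geqslant i_2.\end{cases}$$ This is an (inverse) monoid with identity $(0,0,[0))$. A monoid endomorphism is a semigroup endomorphism fixing the identity. The annihilating monoid endomorphism is the constant map sending every element to $(0,0,[0))$. $\boldsymbol{End}^*(\boldsymbol{B}_{\omega}^{\mathscr{F}})$ is the set of all monoid endomorphisms of $\boldsymbol{B}_{\omega}^{\mathscr{F}}$ that are not injective and are different from the annihilating one; it is a semigroup under composition, where maps are written on the right and composed from left to right: $(x)(fg)=((x)f)g$. For $k\in\omega$ the maps $\gamma_k,\delta_k:\boldsymbol{B}_{\omega}^{\mathscr{F}}\to\boldsymbol{B}_{\omega}^{\mathscr{F}}$ are defined, for all $i,j\in\omega$, by $(i,j,[0))\gamma_k=(i,j,[1))\gamma_k=(ki,kj,[0))$, and $(i,j,[0))\delta_k=(ki,kj,[0))$, $(i,j,[1))\delta_k=(k(i+1),k(j+1),[0))$. For every positive integer $k$ both $\gamma_k$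 and $\delta_k$ belong to $\boldsymbol{End}^*(\boldsymbol{B}_{\omega}^{\mathscr{F}})$. Green's relations on a semigroup $S$, with $S^1$ denoting $S$ with adjoined identity: $a\mathscr{R}b$ iff $aS^1=bS^1$; $a\mathscr{L}b$ iff $S^1a=S^1b$; $a\mathscr{J}b$ iff $S^1aS^1=S^1bS^1$; $\mathscr{D}=\mathscr{L}\circ\mathscr{R}=\mathscr{R}\circ\mathscr{L}$; $\mathscr{H}=\mathscr{L}\cap\mathscr{R}$. *)

(* Defs.v *)
From HB Require Import structures.
From mathcomp Require Import all_boot all_order all_algebra.
From mathcomp Require Import boolp classical_sets.
From mathcomp Require Import zify.

Set Implicit Arguments.
Unset Strict Implicit.
Unset Printing Implicit Defensive.

Local Open Scope classical_set_scope.
Local Open Scope nat_scope.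

Section Green.
Variable S : semigroupType.
Implicit Types (a b : S) (s t : option S).

(* [option S] is S^1, with [None] the adjoined identity; [actr a s] and
   [actl s a] are the products a s and s a in S^1, which always lie in S. *)
Definition actr a s : S := if s is Some x then (a * x)%g else a.
Definition actl s a : S := if s is Some x then (x * a)%g else a.

Definition greenR a b : Prop := range (actr a) = range (actr b).
Definition greenL a b : Prop := range (actl^~ a) = range (actl^~ b).
Definition greenJ a b : Prop :=
  [set actl s (actr a t) | s in [set: option S] & t in [set: option S]] =
  [set actl s (actr b t) | s in [set: option S] & t in [set: option S]].
Definition greenD a b : Prop := exists2 c, greenL a c & greenR c b.
Definition greenH a b : Prop := greenL a b /\ greenR a b.

End Green.

Definition ray (a : nat) : set nat := [set x | a <= x].

(* n + F is a set of integers; [shift n F] is its part lying in nat, which is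
   all that matters since it is only ever intersected with a subset of nat. *)
Definition shift (n : int) (F : set nat) : set nat :=
  [set x | exists2 k, F k & (x%:Z = n + k%:Z)%R].

Definition raysF : set (set nat) := [set ray 0; ray 1].

Lemma shift_ray n a : shift (- n%:Z)%R (ray a) = ray (a - n).
Proof.
apply/seteqP; split => x /=; rewrite /ray /=; first by case=> k; rewrite /ray /=; lia.
by move=> h; exists (x + n); rewrite /ray /=; lia.
Qed.

Lemma rayI a b : ray a `&` ray b = ray (maxn a b).
Proof.
apply/seteqP; split => x; rewrite /ray /=; first by case; lia.
by move=> h; split; lia.
Qed.

Lemma ray_inj : injective ray.
Proof.
move=> a b e; have : ray a a by rewrite /ray /=.
have : ray b b by rewrite /ray /=.
by rewrite -{1}e {2}e /ray /=; lia.
Qed.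

Lemma mem_raysF a : (ray a \in raysF) = (a <= 1).
Proof.
apply/idP/idP; first by rewrite inE => -[] /ray_inj ->.
by case: a => [|[|a]] // _; rewrite inE; [left|right].
Qed.

Lemma raysFP (F : raysF) : exists2 a, a <= 1 & val F = ray a.
Proof. by case: F => F /=; rewrite inE => -[] ->; [exists 0|exists 1]. Qed.

Lemma shiftIl_subproof (n : nat) (F1 F2 : raysF) :
  shift (- n%:Z)%R (val F1) `&` val F2 \in raysF.
Proof.
have [a ha ->] := raysFP F1; have [b hb ->] := raysFP F2.
by rewrite shift_ray rayI mem_raysF; lia.
Qed.

Lemma shiftIr_subproof (n : nat) (F1 F2 : raysF) :
  val F1 `&` shift (- n%:Z)%R (val F2) \in raysF.
Proof. by rewrite setIC shiftIl_subproof. Qed.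

Definition shiftIl n (F1 F2 : raysF) : raysF :=
  exist (fun F => F \in raysF) _ (shiftIl_subproof n F1 F2).
Definition shiftIr n (F1 F2 : raysF) : raysF :=
  exist (fun F => F \in raysF) _ (shiftIr_subproof n F1 F2).

Lemma raysF0_subproof : ray 0 \in raysF. Proof. by rewrite mem_raysF. Qed.
Lemma raysF1_subproof : ray 1 \in raysF. Proof. by rewrite mem_raysF. Qed.
Definition ray0 : raysF := exist (fun F => F \in raysF) _ raysF0_subproof.
Definition ray1 : raysF := exist (fun F => F \in raysF) _ raysF1_subproof.

Definition bicF : Type := (nat * nat * raysF)%type.
HB.instance Definition _ := Choice.on bicF.

(* The nat subtractions below are not truncated; in the first branch
   -(i2 - j1) = j1 - i2 and in the second -(j1 - i2) = i2 - j1. The two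
   branches agree when j1 = i2. *)
Definition bicF_mul (x y : bicF) : bicF :=
  let: (i1, j1, F1) := x in
  let: (i2, j2, F2) := y in
  if j1 <= i2 then (i1 + i2 - j1, j2, shiftIl (i2 - j1) F1 F2)
  else (i1, j1 + j2 - i2, shiftIr (j1 - i2) F1 F2).

Definition bicF_one : bicF := (0, 0, ray0).

Definition code (x : bicF) (i j a : nat) : Prop :=
  [/\ x.1.1 = i, x.1.2 = j & val x.2 = ray a].

Lemma codeP x : exists i j a, code x i j a /\ a <= 1.
Proof.
case: x => [[i j] F]; have [a ha e] := raysFP F.
by exists i, j, a.
Qed.

Lemma code_inj x y i j a : code x i j a -> code y i j a -> x = y.
Proof.
case: x y => [[i1 j1] F1] [[i2 j2] F2] [/= -> -> e1] [/= -> -> e2].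
by congr (_, _, _); apply: val_inj; exact: etrans e1 (esym e2).
Qed.

Lemma code_eq x i j a i' j' a' :
  code x i j a -> code x i' j' a' -> [/\ i = i', j = j' & a = a'].
Proof.
by move=> [<- <- e] [<- <- e2]; split=> //; apply: ray_inj; rewrite -e -e2.
Qed.

Lemma code_mul x y i1 j1 a i2 j2 b : code x i1 j1 a -> code y i2 j2 b ->
  code (bicF_mul x y) (i1 + (i2 - j1)) (j2 + (j1 - i2))
    (maxn (a - (i2 - j1)) (b - (j1 - i2))).
Proof.
case: x y => [[? ?] F1] [[? ?] F2] [/= -> -> e1] [/= -> -> e2].
rewrite /bicF_mul; case: ifP => h; split => /=; try by lia.
  by rewrite /= e1 e2 shift_ray rayI; congr ray; lia.
by rewrite /= e1 e2 shift_ray rayI; congr ray; lia.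
Qed.

Lemma code_one : code bicF_one 0 0 0. Proof. by []. Qed.

Lemma bicF_mulA : associative bicF_mul.
Proof.
move=> x y z.
have [i1 [j1 [a1 [c1 h1]]]] := codeP x.
have [i2 [j2 [a2 [c2 h2]]]] := codeP y.
have [i3 [j3 [a3 [c3 h3]]]] := codeP z.
apply: (code_inj (code_mul c1 (code_mul c2 c3))).
have := code_mul (code_mul c1 c2) c3; congr code; clear; [lia|lia|].
have maxnB m n p : maxn m n - p = maxn (m - p) (n - p) by lia.
rewrite !maxnB maxnA; congr (maxn (maxn _ _) _); lia.
Qed.

Lemma bicF_mul1x : left_id bicF_one bicF_mul.
Proof.
move=> x; have [i [j [a [c h]]]] := codeP x.
by apply: (fun h => code_inj h c); have := code_mul code_one c; congr code; clear; lia.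
Qed.

Lemma bicF_mulx1 : right_id bicF_one bicF_mul.
Proof.
move=> x; have [i [j [a [c h]]]] := codeP x.
by apply: (fun h => code_inj h c); have := code_mul c code_one; congr code; clear; lia.
Qed.

HB.instance Definition _ :=
  isMonoid.Build bicF bicF_mulA bicF_mul1x bicF_mulx1.

Definition annihilating : bicF -> bicF := fun=> 1%g.

Definition EndStar : set (bicF -> bicF) :=
  [set f | [/\ monoid_morphism f, ~ injective f & f <> annihilating]].

Definition gamma (k : nat) (x : bicF) : bicF :=
  let: (i, j, _) := x in (k * i, k * j, ray0).

Definition delta (k : nat) (x : bicF) : bicF :=
  let: (i, j, F) := x in
  if F == ray0 then (k * i, k * j, ray0) else (k * i.+1, k * j.+1, ray0).


Definition bic_p : bicF := (0, 1, ray0).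
Definition bic_q : bicF := (1, 0, ray0).

Lemma code_expp n : code (bic_p ^+ n)%g 0 n 0.
Proof.
elim: n => [|n IH]; first by rewrite expg0.
have cp : code bic_p 0 1 0 by [].
by rewrite expgS; have := code_mul cp IH; congr code; clear; lia.
Qed.

Lemma code_expq n : code (bic_q ^+ n)%g n 0 0.
Proof.
elim: n => [|n IH]; first by rewrite expg0.
have cp : code bic_q 1 0 0 by [].
by rewrite expgS; have := code_mul cp IH; congr code; clear; lia.
Qed.

Lemma code_dec x i j a : code x i j a -> a <= 1 ->
  x = (bic_q ^+ i * (if a is 0 then 1 else (0, 0, ray1) : bicF) * bic_p ^+ j)%g.
Proof.
move=> c ha; set e := (X in (_ * X * _)%g).
have ce : code e 0 0 a by rewrite /e; case: (a) ha => [|[|?]].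
apply: code_inj c _; have := code_mul (code_mul (code_expq i) ce) (code_expp j).
by congr code; clear; lia.
Qed.

Lemma monoid_morphism_exp (f : bicF -> bicF) n x :
  monoid_morphism f -> f (x ^+ n)%g = (f x ^+ n)%g.
Proof. by case=> f1 fM; elim: n => [|n IH]; rewrite ?expg0 // !expgS fM IH. Qed.

Lemma monoid_morphism_pq (f : bicF -> bicF) : monoid_morphism f ->
  exists j, code (f bic_p) 0 j 0 /\ code (f bic_q) j 0 0.
Proof.
move=> [f1 fM].
have pq : (bic_p * bic_q)%g = 1%g :> bicF.
  have cp : code bic_p 0 1 0 by []. have cq : code bic_q 1 0 0 by [].
  by apply: code_inj (code_mul cp cq) _.
have [i [j [a [c h]]]] := codeP (f bic_p).
have [k [l [b [d h']]]] := codeP (f bic_q).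
have := code_mul c d; rewrite -[bicF_mul _ _]fM pq f1.
move=> /(code_eq code_one) [e1 e2 e3]; exists j.
have i0 : i = 0 by lia. have kj : k = j by lia. have l0 : l = 0 by lia.
by have a0 : a = 0 by [lia]; have b0 : b = 0 by [lia]; subst.
Qed.

Lemma monoid_morphism_annihilating (f : bicF -> bicF) : monoid_morphism f ->
  code (f bic_p) 0 0 0 -> f = annihilating.
Proof.
move=> ff cp; have [j [cp' cq]] := monoid_morphism_pq ff.
have [_ j0 _] := code_eq cp cp'; subst j.
have fp : f bic_p = 1%g by apply: code_inj cp code_one.
have fq : f bic_q = 1%g by apply: code_inj cq code_one.
have [f1 fM] := ff.
have fe : f (0, 0, ray1) = 1%g.
  have ce : code (0, 0, ray1) 0 0 1 by [].
  have dp : code bic_p 0 1 0 by []. have dq : code bic_q 1 0 0 by [].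
  have e : (bic_q * bic_p * (0, 0, ray1) = bic_q * bic_p :> bicF)%g.
    have [? ? e3] := code_mul (code_mul dq dp) ce.
    by apply: code_inj (code_mul dq dp); split => //; rewrite e3.
  by have := congr1 f e; rewrite !fM fp fq !mul1g.
apply/funext => x; have [i [j [a [c h]]]] := codeP x.
rewrite (code_dec c h) !fM !(monoid_morphism_exp _ _ ff) fp fq !expg1n.
by case: (a) => [|?]; rewrite ?f1 ?fe !mul1g.
Qed.

Lemma EndStar_comp (f g : bicF -> bicF) :
  f \in EndStar -> g \in EndStar -> g \o f \in EndStar.
Proof.
rewrite !inE => -[ff fI f1] [gg gI g1]; split.
- by split=> [|x y] /=; rewrite ?ff.1 ?gg.1 // ff.2 gg.2.
- by move=> gfI; apply: fI => x y e; apply: gfI; rewrite /= e.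
move=> gf; apply: g1; apply: monoid_morphism_annihilating => //.
have [j [cp cq]] := monoid_morphism_pq ff.
have [m [dp dq]] := monoid_morphism_pq gg.
have fp : f bic_p = (bic_p ^+ j)%g by apply: code_inj cp (code_expp j).
have [j0|j0] := posnP j.
  by case: f1; apply: monoid_morphism_annihilating => //; rewrite j0 in cp.
have gp : g bic_p = (bic_p ^+ m)%g by apply: code_inj dp (code_expp m).
have := congr1 (@^~ bic_p) gf; rewrite /= fp (monoid_morphism_exp _ _ gg) gp -expgnA.
move=> e; have := code_expp (m * j); rewrite e => /(code_eq code_one) [_ mj _].
have m0 : m = 0 by nia.
by rewrite m0; apply: code_one.
Qed.

Lemma code_gamma k x i j a : code x i j a -> code (gamma k x) (k * i) (k * j) 0.
Proof. by case: x => [[? ?] F] [/= -> -> _]. Qed.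

Lemma code_delta k x i j a : code x i j a -> a <= 1 ->
  code (delta k x) (k * (i + a)) (k * (j + a)) 0.
Proof.
case: x => [[? ?] F] [/= -> -> e]; rewrite /delta => ha.
case: eqP => [F0|F0]; case: a e ha => [|[|a]] // e _; split=> //=; try by lia.
- by move: e; rewrite F0 => /ray_inj.
- by move: e; rewrite F0 => /ray_inj.
- by case: F0; apply: val_inj.
- by case: F0; apply: val_inj.
Qed.

Lemma gamma_EndStar k : 0 < k -> gamma k \in EndStar.
Proof.
move=> k0; rewrite inE; split.
- split; first by apply: code_inj (code_gamma k code_one) _; rewrite muln0.
  move=> x y; have [i [j [a [c _]]]] := codeP x.
  have [i' [j' [a' [c' _]]]] := codeP y.
  apply: code_inj (code_gamma k (code_mul c c')) _.
  have := code_mul (code_gamma k c) (code_gamma k c').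
  by rewrite -!mulnBr -!mulnDr !sub0n.
- move=> /(_ (0, 0, ray0) (0, 0, ray1) erefl) [] e.
  by have /ray_inj : ray 0 = ray 1 by [].
- move=> /(congr1 (fun f => (f bic_p).1.2)) /=; lia.
Qed.

Lemma delta_EndStar k : 0 < k -> delta k \in EndStar.
Proof.
move=> k0; rewrite inE; split.
- split; first by apply: code_inj (code_delta k code_one _) _; rewrite ?muln0.
  move=> x y; have [i [j [a [c h]]]] := codeP x.
  have [i' [j' [a' [c' h']]]] := codeP y.
  apply: code_inj (code_delta k (code_mul c c') _) _; first by lia.
  have := code_mul (code_delta k c h) (code_delta k c' h').
  by rewrite -!mulnBr -!mulnDr !sub0n; congr code; congr (k * _); clear; lia.
- move=> dI; have c : code (0, 0, ray1) 0 0 1 by [].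
  have d : code (1, 1, ray0) 1 1 0 by [].
  have e : delta k (0, 0, ray1) = delta k (1, 1, ray0).
    by apply: code_inj (code_delta k c _) (code_delta k d _).
  by have := dI _ _ e.
- have c : code bic_p 0 1 0 by [].
  move=> e; have := code_delta k c isT; rewrite e => /(code_eq code_one) [_ + _].
  by lia.
Qed.

(* The semigroup of the elements of EndStar. Maps are written on the right and
   composed from left to right: (x)(f g) = ((x)f)g. *)
Definition endStar : Type := EndStar.
HB.instance Definition _ := Choice.on endStar.

Definition endStar_mul (f g : endStar) : endStar :=
  exist (fun h => h \in EndStar) (val g \o val f)
    (EndStar_comp (valP f) (valP g)).

Lemma endStar_mulA : associative endStar_mul.
Proof. by move=> f g h; apply: val_inj. Qed.

HB.instance Definition _ := isSemigroup.Build endStar endStar_mulA.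

Definition gammaS k (k_gt0 : 0 < k) : endStar :=
  exist (fun h => h \in EndStar) (gamma k) (gamma_EndStar k_gt0).
Definition deltaS k (k_gt0 : 0 < k) : endStar :=
  exist (fun h => h \in EndStar) (delta k) (delta_EndStar k_gt0).

(* Main.v *)
Require Import Defs.
From mathcomp Require Import all_boot.
From mathcomp Require Import boolp classical_sets.
From mathcomp Require Import zify.

(* A monoid endomorphism f with (0,1,[0))f = (0,k,[0)) is determined by k and by
   the idempotent (0,0,[1))f = (m,m,[a)), where m + a <= k. For k > 0 it is
   injective unless a = 0 and m is 0 (then f = gamma_k) or k (then f = delta_k).
   Since gamma_k and delta_k multiply as the direct product of a two-element left
   zero semigroup and the multiplicative monoid of positive integers, R is
   equality, and L, D, J all relate the elements with the same k. *)

Set Implicit Arguments.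
Unset Strict Implicit.

Local Open Scope classical_set_scope.
Local Open Scope nat_scope.

(** * Classification of the elements of [EndStar] *)

Definition bic_e : bicF := (0, 0, ray1).

Lemma code_e : code bic_e 0 0 1. Proof. by []. Qed.

(** Idempotency of [bic_e] makes the first two coordinates of its image equal, and applying [f] to
    [bic_p * bic_e = bic_p] bounds [m + a] by [k]. *)
Lemma code_morphism_e f k : monoid_morphism f -> code (f bic_p) 0 k 0 ->
  exists m a, [/\ code (f bic_e) m m a, a <= 1 & m + a <= k].
Proof.
move=> ff cp; have [k' [cp' cq]] := monoid_morphism_pq ff.
have [_ ? _] := code_eq cp cp'; subst k'; have [_ fM] := ff.
have [m [n [a [c ha]]]] := codeP (f bic_e).
have ee : (bic_e * bic_e = bic_e)%g.
  by apply: code_inj (code_mul code_e code_e) code_e.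
have pe : (bic_p * bic_e = bic_p)%g.
  have dp : code bic_p 0 1 0 by [].
  by apply: code_inj (code_mul dp code_e) dp.
have := code_mul c c; rewrite -[bicF_mul _ _]fM ee => /(code_eq c) [e1 e2 _].
have := code_mul cp c; rewrite -[bicF_mul _ _]fM pe => /(code_eq cp) [e3 e4 e5].
have mn : m = n by lia.
by subst n; exists m, a; split=> //; lia.
Qed.

(** By [code_dec], x is the product of [bic_q ^+ i], [bic_e] taken b times, and [bic_p ^+ j]; the
    images of the three factors are known. *)
Lemma code_morphism f k m a : monoid_morphism f -> code (f bic_p) 0 k 0 ->
  code (f bic_e) m m a -> forall x i j b, code x i j b -> b <= 1 ->
  code (f x) (k * i + b * m) (k * j + b * m) (b * a).
Proof.
move=> ff cp ce x i j b c hb; have [k' [cp' cq]] := monoid_morphism_pq ff.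
have [_ ? _] := code_eq cp cp'; subst k'; have [f1 fM] := ff.
have fp : f bic_p = (bic_p ^+ k)%g := code_inj cp (code_expp k).
have fq : f bic_q = (bic_q ^+ k)%g := code_inj cq (code_expq k).
rewrite (code_dec c hb) !fM !(monoid_morphism_exp _ _ ff) fp fq -!expgnA.
have d : code (f (if b is 0 then 1%g else bic_e)) (b * m) (b * m) (b * a).
  by case: b {c} hb => [|[|b]] // _; rewrite ?mul0n ?mul1n ?f1.
have := code_mul (code_mul (code_expq (k * i)) d) (code_expp (k * j)).
by congr code; clear; lia.
Qed.

Lemma EndStar_gamma_or_delta f : f \in EndStar ->
  exists2 k, 0 < k & f = gamma k \/ f = delta k.
Proof.
rewrite inE => -[ff fI f1]; have [k [cp _]] := monoid_morphism_pq ff.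
have k0 : 0 < k.
  rewrite lt0n; apply/eqP => k0; rewrite k0 in cp.
  exact: f1 (monoid_morphism_annihilating ff cp).
have [m [a [ce ha hk]]] := code_morphism_e ff cp.
have cf := code_morphism ff cp ce; exists k => //.
have [/eqP a0|a0] := boolP (a == 0); last first.
  (* Here a = 1, so the ray of the image reveals b; then k > 0 recovers i and j, and [f] would be
     injective. *)
  case: fI => x y; have [i [j [b [c hb]]]] := codeP x.
  have [i' [j' [b' [c' hb']]]] := codeP y.
  have d := cf _ _ _ _ c hb; have := cf _ _ _ _ c' hb'.
  move=> + e; rewrite -e => /(code_eq d) [e1 e2 e3].
  have bb : b = b' by nia.
  subst b'; have ii : i = i' by nia.
  have jj : j = j' by nia.
  by subst; apply: code_inj c c'.
subst a; have [/eqP m0|m0] := boolP (m == 0).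
  left; apply/funext => x; have [i [j [b [c hb]]]] := codeP x.
  apply: code_inj (code_gamma k c).
  by have := cf _ _ _ _ c hb; rewrite m0 !muln0 !addn0.
have [/eqP mk|mk] := boolP (m == k).
  right; apply/funext => x; have [i [j [b [c hb]]]] := codeP x.
  apply: code_inj (code_delta k c hb).
  by have := cf _ _ _ _ c hb; rewrite mk !muln0 !mulnDr ![b * k]mulnC.
case: fI => x y; have [i [j [b [c hb]]]] := codeP x.
have [i' [j' [b' [c' hb']]]] := codeP y.
have d := cf _ _ _ _ c hb; have := cf _ _ _ _ c' hb'.
move=> + e; rewrite -e => /(code_eq d) [e1 e2 _].
(* Now 0 < m < k, so m is not a multiple of k: the residue modulo k of the first coordinate reveals
   b, and [f] would again be injective. *)
have small u v : k * u = k * v + m -> False.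
  move=> uv; have : k * v < k * u < k * v.+1 by lia.
  by rewrite !ltn_pmul2l //; lia.
have bb : b = b'.
  case: b b' hb hb' e1 {c c' d e e2} => [|[|b]] [|[|b']] // _ _ e1.
    by case: (small i i'); lia.
  by case: (small i' i); lia.
subst b'; have ii : i = i' by nia.
have jj : j = j' by nia.
by subst; apply: code_inj c c'.
Qed.

(** * Product coordinates on [endStar]: degree and type *)

Definition degree (f : endStar) : nat := (val f bic_p).1.2.
(** [gamma k] sends [bic_e] to the identity and [delta k] sends it to [(k, k, ray0)], so for k > 0
    the first coordinate tells them apart. *)
Definition is_delta (f : endStar) : bool := (val f bic_e).1.1 != 0.

Lemma degree_gammaS k (hk : 0 < k) : degree (gammaS hk) = k.
Proof. by rewrite /degree /= muln1. Qed.

Lemma is_delta_gammaS k (hk : 0 < k) : is_delta (gammaS hk) = false.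
Proof. by rewrite /is_delta /= muln0. Qed.

Lemma degree_deltaS k (hk : 0 < k) : degree (deltaS hk) = k.
Proof.
have c : code bic_p 0 1 0 by [].
by have [_ + _] := code_delta k c isT; rewrite /degree /= => ->; rewrite muln1.
Qed.

Lemma is_delta_deltaS k (hk : 0 < k) : is_delta (deltaS hk) = true.
Proof.
have [+ _ _] := code_delta k code_e isT.
by rewrite /is_delta /= => ->; rewrite muln1 -lt0n.
Qed.

Definition degree_simp :=
  (degree_gammaS, degree_deltaS, is_delta_gammaS, is_delta_deltaS).

Lemma endStarP (f : endStar) :
  exists k (hk : 0 < k), f = gammaS hk \/ f = deltaS hk.
Proof.
have [k hk fE] := EndStar_gamma_or_delta (valP f).
by exists k, hk; case: fE => fE; [left|right]; apply: val_inj.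
Qed.

Lemma degree_gt0 (f : endStar) : 0 < degree f.
Proof. by have [k [hk [->|->]]] := endStarP f; rewrite degree_simp. Qed.

Lemma endStar_eq (f g : endStar) : degree f = degree g -> is_delta f = is_delta g -> f = g.
Proof.
have [k [hk fE]] := endStarP f; have [l [hl gE]] := endStarP g.
by case: fE => ->; case: gE => ->; rewrite !degree_simp => kl // _;
  subst l; rewrite (bool_irrelevance hk hl).
Qed.

Lemma val_endStar_ray0 (f : endStar) i j :
  val f (i, j, ray0) = (degree f * i, degree f * j, ray0).
Proof.
have [k [hk [->|->]]] := endStarP f; rewrite degree_simp //=.
by rewrite eqxx.
Qed.

Lemma val_endStar_image (f : endStar) x :
  exists i j, val f x = (i, j, ray0).
Proof.
have [k [hk [->|->]]] := endStarP f; case: x => [[i j] F].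
  by exists (k * i), (k * j).
by rewrite /=; case: ifP => _; [exists (k * i), (k * j)|exists (k * i.+1), (k * j.+1)].
Qed.

Lemma degreeM (f g : endStar) : degree (f * g)%g = degree f * degree g.
Proof.
by rewrite {1}/degree /= !val_endStar_ray0 /= muln1 mulnC.
Qed.

(** The left factor acts first and lands in the elements with ray [ray0], where [g] only multiplies
    by its positive degree, whatever its type. *)
Lemma is_deltaM (f g : endStar) : is_delta (f * g)%g = is_delta f.
Proof.
rewrite /is_delta /=; have [i [j ->]] := val_endStar_image f bic_e.
by rewrite val_endStar_ray0 /= muln_eq0 negb_or -lt0n degree_gt0.
Qed.

Lemma exists_degree1 b : exists u, degree u = 1 /\ is_delta u = b.
Proof.
by case: b; [exists (deltaS (ltn0Sn 0))|exists (gammaS (ltn0Sn 0))];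
  rewrite !degree_simp.
Qed.

(** A left factor of degree 1 changes the type freely and keeps the degree. *)
Lemma left_factor (f g : endStar) : degree f = degree g -> exists u, f = (u * g)%g.
Proof.
move=> fg; have [u [u1 ub]] := exists_degree1 (is_delta f); exists u.
by apply: endStar_eq; rewrite ?degreeM ?is_deltaM // u1 mul1n.
Qed.

(** * Green's relations in terms of degree and type *)

Lemma degree_actr (f : endStar) s : degree f %| degree (actr f s).
Proof. by case: s => [x|] //=; rewrite degreeM dvdn_mulr. Qed.

Lemma degree_actl (f : endStar) s : degree f %| degree (actl s f).
Proof. by case: s => [x|] //=; rewrite degreeM dvdn_mull. Qed.

(** The degrees divide each other, and right multiplication preserves the type. *)
Lemma greenRP (f g : endStar) : greenR f g <-> f = g.
Proof.
split=> [fg|->] //.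
have [s _ sE] : range (actr g) f by rewrite -fg; exists None.
have [t _ tE] : range (actr f) g by rewrite fg; exists None.
apply: endStar_eq.
  by apply/eqP; rewrite eqn_dvd -{1}tE -{3}sE !degree_actr.
by rewrite -sE; case: s {sE} => [x|] //=; rewrite is_deltaM.
Qed.

Lemma range_actl_sub (f g : endStar) : degree f = degree g ->
  range (fun s => actl s f) `<=` range (fun s => actl s g).
Proof.
move=> /left_factor [u ->] _ [[x|] _ <-]; last by exists (Some u).
by exists (Some (x * u)%g) => //=; rewrite mulgA.
Qed.

Lemma greenLP (f g : endStar) : greenL f g <-> degree f = degree g.
Proof.
split=> [fg|fg]; last by apply/seteqP; split; apply: range_actl_sub.
have [s _ sE] : range (fun s => actl s g) f by rewrite -fg; exists None.
have [t _ tE] : range (fun s => actl s f) g by rewrite fg; exists None.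
by apply/eqP; rewrite eqn_dvd -{1}tE -{3}sE !degree_actl.
Qed.

(** As R is equality, D reduces to L. *)
Lemma greenDP (f g : endStar) : greenD f g <-> degree f = degree g.
Proof.
split=> [[h /greenLP fh /greenRP <-] //|fg].
by exists g; [apply/greenLP|apply/greenRP].
Qed.

Lemma ideal_sub (f g : endStar) : degree f = degree g ->
  [set actl s (actr f t) | s in [set: option endStar] & t in [set: option endStar]]
  `<=` [set actl s (actr g t) | s in [set: option endStar] & t in [set: option endStar]].
Proof.
move=> /left_factor [u ->] _ [s _ [t _ <-]].
exists (Some (if s is Some x then x * u else u)%g) => //; exists t => //.
by case: s t => [x|] [y|] //=; rewrite !mulgA.
Qed.

(** Every element of the principal ideal of b has degree divisible by that of b, so equal ideals
    force mutual divisibility. *)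
Lemma greenJP (f g : endStar) : greenJ f g <-> degree f = degree g.
Proof.
rewrite /greenJ; split=> [fg|fg]; last by apply/seteqP; split; apply: ideal_sub.
have dvd a b : [set actl s (actr b t) | s in [set: option endStar]
                  & t in [set: option endStar]] a -> degree b %| degree a.
  by move=> [s _ [t _ <-]]; apply: dvdn_trans (degree_actr _ _) (degree_actl _ _).
apply/eqP; rewrite eqn_dvd !dvd //; first by rewrite -fg; exists None => //; exists None.
by rewrite fg; exists None => //; exists None.
Qed.

Theorem theorem3 :
  (forall (k1 k2 : nat) (h1 : 0 < k1) (h2 : 0 < k2),
     greenR (gammaS h1) (gammaS h2) <-> k1 = k2) /\
  (forall (k1 k2 : nat) (h1 : 0 < k1) (h2 : 0 < k2),
     ~ greenR (gammaS h1) (deltaS h2)) /\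
  (forall (k1 k2 : nat) (h1 : 0 < k1) (h2 : 0 < k2),
     greenR (deltaS h1) (deltaS h2) <-> k1 = k2) /\
  (forall (k1 k2 : nat) (h1 : 0 < k1) (h2 : 0 < k2),
     greenL (gammaS h1) (gammaS h2) <-> k1 = k2) /\
  (forall (k1 k2 : nat) (h1 : 0 < k1) (h2 : 0 < k2),
     greenL (gammaS h1) (deltaS h2) <-> k1 = k2) /\
  (forall (k1 k2 : nat) (h1 : 0 < k1) (h2 : 0 < k2),
     greenL (deltaS h1) (deltaS h2) <-> k1 = k2) /\
  (forall e1 e2 : endStar, greenH e1 e2 <-> e1 = e2) /\
  (forall e1 e2 : endStar,
     greenD e1 e2 <->
     e1 = e2 \/
     exists (k : nat) (hk : 0 < k),
       [set gammaS hk; deltaS hk] e1 /\ [set gammaS hk; deltaS hk] e2) /\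
  (forall e1 e2 : endStar, greenD e1 e2 <-> greenJ e1 e2).
Proof.
split=> [k l hk hl|]; first split=> [/greenRP/(congr1 degree)|kl].
- by rewrite !degree_simp.
- by apply/greenRP/endStar_eq; rewrite !degree_simp.
split=> [k l hk hl /greenRP/(congr1 is_delta)|]; first by rewrite !degree_simp.
split=> [k l hk hl|]; first split=> [/greenRP/(congr1 degree)|kl].
- by rewrite !degree_simp.
- by apply/greenRP/endStar_eq; rewrite !degree_simp.
split=> [k l hk hl|]; first by rewrite greenLP !degree_simp.
split=> [k l hk hl|]; first by rewrite greenLP !degree_simp.
split=> [k l hk hl|]; first by rewrite greenLP !degree_simp.
split=> [f g|]; first by split=> [[_ /greenRP]|->].
split=> f g; last by rewrite greenDP greenJP.
rewrite greenDP; split=> [fg|[->//|[k [hk [fE gE]]]]]; last first.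
  by case: fE => ->; case: gE => ->; rewrite !degree_simp.
have [k [hk fE]] := endStarP f; have [l [hl gE]] := endStarP g.
have kl : k = l by move: fg; case: fE => ->; case: gE => ->; rewrite !degree_simp.
(* The two positivity proofs must be identified before [f] and [g] lie in the same pair. *)
by subst l; rewrite (bool_irrelevance hl hk) in gE; right; exists k, hk.
Qed.
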